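(* Any simple module over $\mathfrak{b}^{(2)}$ is, up to parity change, isomorphic to $U\oplus G_{\frac12}U$, where $U$ is a simple $\mathfrak{b}^{(2)}_{\bar0}$-module.
   Context: All vector spaces are over $\mathbb{C}$. A module over a Lie superalgebra $L=L_{\bar0}\oplus L_{\bar1}$ is a $\mathbb{Z}_2$-graded vector space $V=V_{\bar0}\oplus V_{\bar1}$ with a bilinear action such that $x(yv)-(-1)^{|x||y|}y(xv)=[x,y]v$ for homogeneous $x,y\in L$, $v\in V$, and $L_iV_j\subseteq V_{i+j}$ for $i,j\in\mathbb{Z}_2$; submodules are $\mathbb{Z}_2$-graded. The parity change functor $\Pi$ interchanges the even and odd parts of a module; ''up to parity change'' means after possibly replacing the module $V$ by $\Pi(V)$. $\mathfrak{b}^{(2)}$ is the 5-dimensional Lie superalgebra with even part $\mathfrak{b}^{(2)}_{\bar0}=\mathbb{C}L_0\oplus\mathbb{C}L_1\oplus\mathbb{C}L_2$ and odd part $\mathfrak{b}^{(2)}_{\bar1}=\mathbb{C}G_{\frac12}\oplus\mathbb{C}G_{\frac32}$, with brackets $[L_m,L_n]=(m-n)L_{m+n}$, $[L_m,G_r]=(\frac m2-r)G_{m+r}$, $[G_r,G_s]=2L_{r+s}$, where $L_i:=0$ for $i>2$ and $G_r:=0$ for $r>\frac32$. (It is the quotient of $\mathfrak{b}=\bigoplus_{i\ge0}\mathbb{C}L_i\oplus\bigoplus_{i\ge1}\mathbb{C}G_{i-\frac12}$, inside the Neveu-Schwarz algebra, by the ideal $\bigoplus_{m>2}\mathbb{C}L_m\oplus\bigoplus_{m>2}\mathbb{C}G_{m-\frac12}$.)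 ''$U\oplus G_{\frac12}U$'' denotes a $\mathfrak{b}^{(2)}$-module whose even part contains $U$ as a simple $\mathfrak{b}^{(2)}_{\bar0}$-submodule and whose underlying space is the direct sum of $U$ and its image $G_{\frac12}U$ under the action of $G_{\frac12}$. *)

(* Defs.v *)
From mathcomp Require Import all_boot all_order all_algebra.
From mathcomp Require Import ring.
From mathcomp Require Import boolp classical_sets reals.
From mathcomp.real_closed Require Import complex.

Set Implicit Arguments.
Unset Strict Implicit.
Unset Printing Implicit Defensive.

Import Order.TTheory GRing.Theory Num.Theory.
Local Open Scope classical_set_scope.
Local Open Scope ring_scope.

(* Z_2 is [bool] with [addb]: [false] is the even degree, [true] the odd one. *)

Section Superspaces.
Variable F : numFieldType.

Definition subspace (V : lmodType F) (A : set V) : Prop := submod_closed [in A].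

Definition direct_sum (V : lmodType F) (A B : set V) : Prop :=
  forall v : V, exists! p : V * V, [/\ A p.1, B p.2 & v = p.1 + p.2].

Record superspace := Superspace {
  carrier :> lmodType F;
  homog : bool -> set carrier;
  homog_subspace : forall i, subspace (homog i);
  homog_direct : direct_sum (homog false) (homog true)
}.

Record lie_superalgebra := LieSuperalgebra {
  lsa_space :> superspace;
  bracket : lsa_space -> lsa_space -> lsa_space;
  bracket_linearr : forall x, linear (bracket x);
  bracket_linearl : forall y, linear (bracket^~ y);
  bracket_homog : forall i j x y,
    homog i x -> homog j y -> homog (i (+) j) (bracket x y);
  bracket_skew : forall i j x y, homog i x -> homog j y ->
    bracket x y = - ((-1) ^+ (i && j) *: bracket y x);
  bracket_jacobi : forall i j k x y z, homog i x -> homog j y -> homog k z ->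
    bracket x (bracket y z) =
    bracket (bracket x y) z + (-1) ^+ (i && j) *: bracket y (bracket x z)
}.

Variable L : lie_superalgebra.

Record smodule := SModule {
  smod_space :> superspace;
  act : L -> smod_space -> smod_space;
  act_linearr : forall x, linear (act x);
  act_linearl : forall v, linear (act^~ v);
  act_homog : forall i j x v,
    homog i x -> homog j v -> homog (i (+) j) (act x v);
  act_bracket : forall i j x y v, homog i x -> homog j y ->
    act x (act y v) - (-1) ^+ (i && j) *: act y (act x v) = act (bracket x y) v
}.

Definition graded (V : superspace) (N : set V) : Prop :=
  forall v0 v1, homog false v0 -> homog true v1 -> N (v0 + v1) -> N v0 /\ N v1.

Definition submodule (V : smodule) (N : set V) : Prop :=
  [/\ subspace N, graded N & forall x v, N v -> N (act x v)].

Definition simple_module (V : smodule) : Prop :=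
  (exists v : V, v <> 0) /\
  forall N : set V, submodule N -> N = [set 0] \/ N = [set: V].

(* L_0bar-submodules need not be graded in V. *)
Definition even_submodule (V : smodule) (U : set V) : Prop :=
  subspace U /\ forall x u, homog false x -> U u -> U (act x u).

Definition simple_even_submodule (V : smodule) (U : set V) : Prop :=
  [/\ even_submodule U, U <> [set 0] &
      forall W : set V, even_submodule W -> W `<=` U -> W = [set 0] \/ W = U].

Definition isomorphic (V W : smodule) : Prop :=
  exists f : {linear V -> W},
    [/\ bijective f, forall i v, homog i v -> homog i (f v) &
        forall x v, f (act x v) = act x (f v)].

Section ParityChange.
Variable V : smodule.

Fact parity_change_direct : direct_sum (@homog V true) (@homog V false).
Proof.
move=> v; have [[a b] /= [[ha hb ->] u]] := homog_direct v.
exists (b, a); split=> /= [|[c d] /= [hc hd e]]; first by split=> //; rewrite addrC.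
by have [-> ->] := u (d, c) (And3 hd hc (etrans e (addrC c d))).
Qed.

Definition parity_change_space : superspace :=
  @Superspace V (fun i => @homog V (~~ i)) (fun i => @homog_subspace V (~~ i))
    parity_change_direct.

Fact parity_change_homog i j (x : L) (v : parity_change_space) :
  homog i x -> homog j v -> @homog parity_change_space (i (+) j) (act x (v : V)).
Proof. by move=> hx hv; have := act_homog hx hv; rewrite /= addbN. Qed.

(* The action is unchanged; the convention with sign (-1)^|x| gives an isomorphic
   module. *)
Definition parity_change : smodule :=
  @SModule parity_change_space (@act V) (@act_linearr V) (@act_linearl V)
    parity_change_homog (@act_bracket V).

End ParityChange.

End Superspaces.

Section B2.
Variable F : numFieldType.

(* Coordinates 0, 1, 2, 3, 4 are those on L_0, G_(1/2), L_1, G_(3/2), L_2: the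
   index is twice the degree, and its parity is that of the basis vector. *)
Definition b2_homog (i : bool) : set 'rV[F]_5 :=
  [set x | forall k : 'I_5, x 0 k != 0 -> odd k = i].

(* [b2_coef p q] is the coefficient of the bracket of the vectors of degrees
   p/2 and q/2 along the vector of degree (p + q)/2. *)
Definition b2_coef (p q : nat) : F :=
  match odd p, odd q with
  | false, false => p%:R / 2 - q%:R / 2
  | false, true => p%:R / 2 / 2 - q%:R / 2
  | true, false => - (q%:R / 2 / 2 - p%:R / 2)
  | true, true => 2
  end.

Definition b2_bracket (x y : 'rV[F]_5) : 'rV[F]_5 :=
  \row_k \sum_(i < 5) \sum_(j < 5 | (i + j == k)%N) b2_coef i j * x 0 i * y 0 j.

Fact b2_homog_subspace i : subspace (b2_homog i).
Proof.
split=> [|a u v]; rewrite !inE; first by move=> k; rewrite mxE eqxx.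
move=> hu hv k; rewrite !mxE; have [/eqP u0|/hu //] := boolP (u 0 k == 0).
by rewrite u0 mulr0 add0r => /hv.
Qed.

Fact b2_homog0 i x (k : 'I_5) : b2_homog i x -> odd k != i -> x 0 k = 0.
Proof. by move=> hx; apply: contra_neq_eq => /hx. Qed.

Fact b2_homog_direct : direct_sum (b2_homog false) (b2_homog true).
Proof.
move=> v; exists (\row_k (if odd k then 0 else v 0 k),
                  \row_k (if odd k then v 0 k else 0)); split=> /=.
  by split=> [k|k|]; rewrite ?mxE; try (by case: odd; rewrite ?eqxx);
    apply/rowP=> k; rewrite !mxE; case: odd; rewrite ?addr0 ?add0r.
move=> [a b] /= [ha hb ->]; congr pair; apply/rowP=> k; rewrite !mxE.
  by case: ifP => k_odd; [rewrite (b2_homog0 ha) ?k_odd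
    | rewrite (b2_homog0 hb) ?k_odd // addr0].
by case: ifP => k_odd; [rewrite (b2_homog0 ha) ?k_odd // add0r
  | rewrite (b2_homog0 hb) ?k_odd].
Qed.

Definition b2_space : superspace F :=
  Superspace b2_homog_subspace b2_homog_direct.

Fact b2_linearr x : linear (b2_bracket x).
Proof.
move=> a u v; apply/rowP=> k; rewrite !mxE mulr_sumr -big_split; apply: eq_bigr => i _.
rewrite mulr_sumr -big_split; apply: eq_bigr => j _ /=; rewrite !mxE; ring.
Qed.

Fact b2_linearl y : linear (b2_bracket^~ y).
Proof.
move=> a u v; apply/rowP=> k; rewrite !mxE mulr_sumr -big_split; apply: eq_bigr => i _.
rewrite mulr_sumr -big_split; apply: eq_bigr => j _ /=; rewrite !mxE; ring.
Qed.

Fact b2_bracket_homog i j x y :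
  b2_homog i x -> b2_homog j y -> b2_homog (i (+) j) (b2_bracket x y).
Proof.
move=> hx hy k; apply: contra_neqP => /eqP kij.
rewrite mxE big1 // => p _; rewrite big1 // => q /eqP pqk.
have [->|/hx hp] := eqVneq (x 0 p) 0; first by rewrite mulr0 mul0r.
have [->|/hy hq] := eqVneq (y 0 q) 0; first by rewrite mulr0.
by move: kij; rewrite -pqk oddD hp hq eqxx.
Qed.

Fact b2_bracketE x y (o := fun n => inord n : 'I_5) (k : 'I_5) :
  b2_bracket x y 0 k =
  [:: 0;
      - (1 / 2) * x 0 (o 0%N) * y 0 (o 1%N) + 1 / 2 * x 0 (o 1%N) * y 0 (o 0%N);
      x 0 (o 2%N) * y 0 (o 0%N) - x 0 (o 0%N) * y 0 (o 2%N)
        + 2 * x 0 (o 1%N) * y 0 (o 1%N);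
      - (3 / 2) * x 0 (o 0%N) * y 0 (o 3%N) + 3 / 2 * x 0 (o 3%N) * y 0 (o 0%N);
      2 * x 0 (o 4%N) * y 0 (o 0%N) - 2 * x 0 (o 0%N) * y 0 (o 4%N)
        + 2 * x 0 (o 1%N) * y 0 (o 3%N) + 2 * x 0 (o 3%N) * y 0 (o 1%N)]`_k.
Proof.
rewrite mxE; under eq_bigr do rewrite big_mkcond.
rewrite !(big_ord_recl, big_ord0) /=.
have E (i : 'I_5) (n : nat) : i = n :> nat -> i = o n.
  by move=> <-; rewrite /o inord_val.
rewrite (E (lift ord0 (lift ord0 (lift ord0 (lift ord0 ord0)))) 4%N erefl).
rewrite (E (lift ord0 (lift ord0 (lift ord0 ord0))) 3%N erefl).
rewrite (E (lift ord0 (lift ord0 ord0)) 2%N erefl) (E (lift ord0 ord0) 1%N erefl).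
rewrite (E ord0 0%N erefl).
by rewrite {E}/o; case: k => -[|[|[|[|[|//]]]]] hk /=;
  rewrite ?inordK //= /b2_coef /bump /=; field; rewrite ?pnatr_eq0.
Qed.

Fact b2_homogE i x : b2_homog i x ->
  if i then [/\ x 0 (inord 0) = 0, x 0 (inord 2) = 0 & x 0 (inord 4) = 0]
  else x 0 (inord 1) = 0 /\ x 0 (inord 3) = 0.
Proof. by case: i => hx; split; apply: (b2_homog0 hx); rewrite inordK. Qed.

Fact b2_skew i j x y : b2_homog i x -> b2_homog j y ->
  b2_bracket x y = - ((-1) ^+ (i && j) *: b2_bracket y x).
Proof.
move=> /b2_homogE hx /b2_homogE hy; apply/rowP=> k.
rewrite [RHS]mxE [X in - X]mxE !b2_bracketE.
by case: k => -[|[|[|[|[|//]]]]] hk /=;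
  case: i hx => -[h1 h2] *; case: j hy => -[h3 h4] *;
  rewrite ?(h1, h2, h3, h4); field; rewrite ?pnatr_eq0.
Qed.

Fact b2_jacobi i j k x y z : b2_homog i x -> b2_homog j y -> b2_homog k z ->
    b2_bracket x (b2_bracket y z) =
    b2_bracket (b2_bracket x y) z + (-1) ^+ (i && j) *: b2_bracket y (b2_bracket x z).
Proof.
move=> /b2_homogE hx /b2_homogE hy /b2_homogE hz; apply/rowP=> n.
rewrite [RHS]mxE [X in _ + X]mxE !b2_bracketE !inordK //=.
by case: n => -[|[|[|[|[|//]]]]] hn /=;
  case: i hx => -[? ?] *; case: j hy => -[? ?] *; case: k hz => -[? ?] *;
  repeat match goal with H : _ = 0 |- _ => rewrite ?H; clear H end;
  field; rewrite ?pnatr_eq0.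
Qed.

Definition b2 : lie_superalgebra F :=
  @LieSuperalgebra F b2_space b2_bracket b2_linearr b2_linearl b2_bracket_homog
    b2_skew b2_jacobi.

(* [b2_L m] is L_m and [b2_G k] is G_(k + 1/2); they vanish for m > 2, k > 1. *)
Definition b2_vect (p : nat) : b2 := \row_(k < 5) (k == p :> nat)%:R.
Definition b2_L (m : nat) : b2 := b2_vect m.*2.
Definition b2_G (k : nat) : b2 := b2_vect k.*2.+1.

Fact b2_vect_bracket p q :
  bracket (b2_vect p) (b2_vect q) = b2_coef p q *: b2_vect (p + q)%N.
Proof.
apply/rowP=> k; rewrite !mxE [k == _ :> nat]eq_sym.
have [pqk|pqk] := eqVneq (p + q)%N (k : nat).
  have p5 : (p < 5)%N by apply: leq_ltn_trans (ltn_ord k); rewrite -pqk leq_addr.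
  have q5 : (q < 5)%N by apply: leq_ltn_trans (ltn_ord k); rewrite -pqk leq_addl.
  rewrite (bigD1 (Ordinal p5)) //= (bigD1 (Ordinal q5)) /= ?pqk // !mxE !eqxx !mulr1.
  rewrite !big1 ?addr0 // => [i ip|j /andP[_ jq]]; last first.
    by rewrite !mxE -[j == q :> nat]/(j == Ordinal q5) (negPf jq) mulr0.
  rewrite big1 // => j _.
  by rewrite !mxE -[i == p :> nat]/(i == Ordinal p5) (negPf ip) mulr0 mul0r.
rewrite mulr0 big1 // => i _; rewrite big1 // => j /eqP ijk; rewrite !mxE.
have [ip|_] := eqVneq (i : nat) p; last by rewrite mulr0 mul0r.
have [jq|_] := eqVneq (j : nat) q; last by rewrite mulr0.
by rewrite -ijk ip jq eqxx in pqk.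
Qed.

Lemma b2_bracket_LL m n :
  bracket (b2_L m) (b2_L n) = (m%:R - n%:R) *: b2_L (m + n).
Proof.
rewrite /b2_L b2_vect_bracket -doubleD /b2_coef !odd_double.
by congr (_ *: _); rewrite -!muln2 !natrM; field; rewrite ?pnatr_eq0.
Qed.

Lemma b2_bracket_LG m k :
  bracket (b2_L m) (b2_G k) = (m%:R / 2 - (k%:R + 1 / 2)) *: b2_G (m + k).
Proof.
rewrite /b2_L /b2_G b2_vect_bracket addnS -doubleD /b2_coef /= !odd_double.
by congr (_ *: _); rewrite -natr1 -!muln2 !natrM; field; rewrite ?pnatr_eq0.
Qed.

Lemma b2_bracket_GG k l : bracket (b2_G k) (b2_G l) = 2 *: b2_L (k + l).+1.
Proof.
by rewrite /b2_L /b2_G b2_vect_bracket addSn addnS -doubleD /b2_coef /= !odd_double.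
Qed.

(* The G_(1/2)-image of U may be zero. *)
Definition is_sum_U_GU (M : smodule b2) (U : set M) : Prop :=
  [/\ U `<=` homog false, simple_even_submodule U &
      direct_sum U (act (b2_G 0) @` U)].

End B2.

(* Main.v *)
Require Import Defs.
From HB Require Import structures.
From mathcomp Require Import all_boot all_order all_algebra.
From mathcomp Require Import boolp classical_sets reals.
From mathcomp.real_closed Require Import complex.

(** Write G for G_(1/2) and H for G_(3/2), and let V be simple.  Since
    H^2 = L_3 = 0 in b^(2) ([act_G1_G1]), the kernel of H is nonzero; it is graded, so
    after a parity change it contains a nonzero even vector
    ([ker_G1_homogeneous]).

    The mechanism is [sum_GW_submodule]: if W is an L_0bar-stable space of even
    vectors killed by H, then W + G W is a submodule, because G^2 = L_1,
    H G = 2 L_2 - G H, and [L_m, G] is a multiple of G_(m + 1/2), which maps W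
    into G W.  If moreover W is nonzero, then W + G W = V, and comparing even
    parts gives W = V_0bar and G W = V_1bar.

    The even part K of the kernel of H is such a space, hence K = V_0bar, so H
    kills V_0bar.  Consequently every nonzero L_0bar-submodule W of V_0bar is
    again such a space and equals V_0bar: U := V_0bar is simple, and
    V = U + G U is direct by parity. *)

Set Implicit Arguments.
Unset Strict Implicit.
Unset Printing Implicit Defensive.

Import Order.TTheory GRing.Theory Num.Theory.
Local Open Scope classical_set_scope.
Local Open Scope ring_scope.

(** This makes the generic linearity lemmas apply to [act x]. *)
HB.instance Definition _ (F : numFieldType) (L : lie_superalgebra F)
    (V : smodule L) (x : L) :=
  GRing.isLinear.Build F V V _ (act x) (act_linearr x).

(** * Subspaces and gradings *)

Section Subspaces.
Variables (F : numFieldType) (V : lmodType F) (A : set V).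
Hypothesis subA : subspace A.

Lemma subspace0 : A 0.
Proof. by have [] := subA; rewrite inE. Qed.

Lemma subspaceP a u v : A u -> A v -> A (a *: u + v).
Proof. by have [_ h] := subA => Au Av; have := h a u v; rewrite !inE; apply. Qed.

Lemma subspaceD u v : A u -> A v -> A (u + v).
Proof. by move=> Au Av; rewrite -[u]scale1r; apply: subspaceP. Qed.

Lemma subspaceZ a u : A u -> A (a *: u).
Proof. by move=> Au; rewrite -[_ *: _]addr0; apply: subspaceP subspace0. Qed.

End Subspaces.

Lemma subspaceI (F : numFieldType) (V : lmodType F) (A : set V) :
  A 0 -> (forall a u v, A u -> A v -> A (a *: u + v)) -> subspace A.
Proof. by move=> A0 h; split=> [|a u v]; rewrite !inE //; apply: h. Qed.

Section Grading.
Variables (F : numFieldType) (V : superspace F).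

Lemma homog_eq (a b c d : V) : homog false a -> homog true b ->
  homog false c -> homog true d -> a + b = c + d -> a = c /\ b = d.
Proof.
move=> ha hb hc hd e; have [p [_ u]] := homog_direct (a + b).
have p1 := u (a, b) (And3 ha hb erefl); have p2 := u (c, d) (And3 hc hd e).
by move: p2; rewrite p1 => -[-> ->].
Qed.

Lemma homog0 i : homog i (0 : V).
Proof. exact: (subspace0 (@homog_subspace _ V i)). Qed.

Lemma homog_decomp (v : V) :
  exists a b, [/\ homog false a, homog true b & v = a + b].
Proof. by have [[a b] [[? ? ?] _]] := homog_direct v; exists a, b. Qed.

End Grading.

(** * Action of the basis vectors *)

Section Action.
Variables (F : numFieldType).

Section AnySuperalgebra.
Variables (L : lie_superalgebra F) (V : smodule L).

Lemma act_scalel a x (v : V) : act (a *: x) v = a *: act x v.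
Proof.
have act0l : act 0 v = 0.
  by have := act_linearl v (-1) 0 0; rewrite scaler0 add0r scaleN1r addNr.
by have := act_linearl v a x 0; rewrite !addr0 act0l addr0.
Qed.

Lemma simple_parity_change : simple_module V -> simple_module (parity_change V).
Proof.
move=> [nz h]; split=> // N [sN gN aN]; apply: h; split=> // v0 v1 h0 h1 Nv.
by have [] := gN v1 v0 h1 h0; [rewrite addrC|].
Qed.

Lemma isomorphic_refl : isomorphic V V.
Proof. by exists idfun; split=> //; exists idfun. Qed.

End AnySuperalgebra.

Variable V : smodule (b2 F).
Implicit Types (v w : V) (W : set V).

Notation G := (b2_G F 0).
Notation H := (b2_G F 1).

Lemma b2_vect_homog p : homog (odd p) (b2_vect F p).
Proof.
by move=> k; rewrite mxE; have [->|] := eqVneq (k : nat) p; rewrite ?eqxx.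
Qed.

Lemma b2_L_homog m : homog false (b2_L F m).
Proof. by have := @b2_vect_homog m.*2; rewrite odd_double. Qed.

Lemma b2_G_homog k : homog true (b2_G F k).
Proof. by have := @b2_vect_homog k.*2.+1; rewrite /= odd_double. Qed.

Lemma b2_vect_ge5 p : (4 < p)%N -> b2_vect F p = 0.
Proof.
move=> p5; apply/rowP=> k; rewrite !mxE.
by have [kp|//] := eqVneq (k : nat) p; have := ltn_ord k; rewrite kp ltnNge p5.
Qed.

Lemma act_vect_ge5 p v : (4 < p)%N -> act (b2_vect F p) v = 0.
Proof.
by move=> /b2_vect_ge5 ->; rewrite -[X in act X _](scale0r 0) act_scalel scale0r.
Qed.

Lemma act_GG k l v :
  act (b2_G F k) (act (b2_G F l) v) =
  2 *: act (b2_L F (k + l).+1) v - act (b2_G F l) (act (b2_G F k) v).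
Proof.
rewrite -act_scalel -b2_bracket_GG -(act_bracket v (@b2_G_homog k) (@b2_G_homog l)).
by rewrite expr1 scaleN1r opprK addrK.
Qed.

Lemma act_LG m k v :
  act (b2_L F m) (act (b2_G F k) v) =
  act (b2_G F k) (act (b2_L F m) v)
  + (m%:R / 2 - (k%:R + 1 / 2)) *: act (b2_G F (m + k)) v.
Proof.
rewrite -act_scalel -b2_bracket_LG -(act_bracket v (@b2_L_homog m) (@b2_G_homog k)).
by rewrite expr0 scale1r addrCA subrr addr0.
Qed.

Lemma act_GG_diag k v :
  act (b2_G F k) (act (b2_G F k) v) = act (b2_L F (k + k).+1) v.
Proof.
apply: (@scalerI _ _ (2 : F)); first by rewrite pnatr_eq0.
by rewrite [X in X *: act (b2_G _ _) _]mulr2n scalerDl scale1r {1}act_GG subrK.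
Qed.

Lemma act_G1_G1 v : act H (act H v) = 0.
Proof. by rewrite act_GG_diag act_vect_ge5. Qed.

(** Restricting the hypothesis to the nonzero coordinates of [x] lets the same
    lemma serve for all [x] and for even [x], whose odd coordinates vanish. *)
Lemma subspace_act W (x : b2 F) w : subspace W ->
  (forall k : 'I_5, (x : 'rV[F]_5) 0 k != 0 -> W (act (b2_vect F k) w)) ->
  W (act x w).
Proof.
move=> sW hW.
have -> : x = \sum_(k < 5) (x : 'rV[F]_5) 0 k *: b2_vect F k.
  apply/rowP=> j; rewrite summxE (bigD1 j) //= !mxE eqxx mulr1 big1 ?addr0 // => k kj.
  by rewrite !mxE -[j == k :> nat]/(j == k) eq_sym (negPf kj) mulr0.
elim/big_rec: _ => [|k y _ Wy].
  by rewrite -(scale0r (0 : b2 F)) act_scalel scale0r; apply: subspace0.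
have [->|/hW Wk] := eqVneq ((x : 'rV[F]_5) 0 k) 0; first by rewrite scale0r add0r.
by rewrite (act_linearl w); apply: subspaceP.
Qed.

Lemma act_G_odd k v : homog false v -> homog true (act (b2_G F k) v).
Proof. exact: act_homog (@b2_G_homog k). Qed.

(** * The submodule generated by even vectors killed by G_(3/2) *)

Definition sum_GW W : set V :=
  [set v | exists w w', [/\ W w, W w' & v = w + act G w']].

(** For w, w' in W, the relations G^2 = L_1, H G = 2 L_2 - G H and H W = 0 give
    G (w + G w') = L_1 w' + G w and H (w + G w') = 2 L_2 w', while
    L_m (w + G w') = L_m w + G L_m w' + c G_(m + 1/2) w' for a scalar c. The
    grading of W + G W comes from W being even and G W odd. *)
Lemma sum_GW_submodule W : even_submodule W -> W `<=` homog false ->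
  (forall w, W w -> act H w = 0) -> submodule (sum_GW W).
Proof.
move=> [sW aW] W0 HW.
have LW m w : W w -> W (act (b2_L F m) w) by apply: aW; apply: b2_L_homog.
have sN : subspace (sum_GW W).
  apply: subspaceI => [|a _ _ [u [u' [Wu Wu' ->]]] [w [w' [Ww Ww' ->]]]].
    by exists 0, 0; rewrite linear0 addr0; split=> //; apply: subspace0.
  exists (a *: u + w), (a *: u' + w'); split; try exact: subspaceP.
  by rewrite linearP scalerDr addrACA.
split=> // [v0 v1 h0 h1 [w [w' [Ww Ww' e]]]|x _ [w [w' [Ww Ww' ->]]]].
  have [-> ->] := homog_eq h0 h1 (W0 _ Ww) (act_G_odd 0 (W0 _ Ww')) e.
  split; [exists w, 0 | exists 0, w']; split=> //; try exact: subspace0.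
    by rewrite linear0 addr0.
  by rewrite add0r.
apply: subspace_act => // k _; move: (nat_of_ord k) => {k} p.
rewrite -(odd_double_half p); case: (odd p).
  case: p./2 => [|[|k]].
  - exists (act (b2_L F 1) w'), w; split=> //; first exact: LW.
    by rewrite linearD /= addrC; congr (_ + _); apply: (act_GG_diag 0).
  - exists (2 *: act (b2_L F 2) w'), 0; split; try exact: (subspace0 sW).
      by apply: subspaceZ => //; apply: LW.
    by rewrite linearD linear0 /= [act _ w]HW // act_GG HW // linear0 add0r subr0 addr0.
  - by rewrite act_vect_ge5 ?doubleS //; apply: (subspace0 sN).
(* The bracket of L_m and G_(1/2) only contributes when m = 0, where it is
   - 1/2 G_(1/2): for m = 1 it is a multiple of G_(3/2), which kills W, and for
   m > 1 it vanishes. *)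
set m := p./2; rewrite add0n linearD -[b2_vect F m.*2]/(b2_L F m) /= act_LG addn0.
exists (act (b2_L F m) w).
exists (act (b2_L F m) w' + (if m is 0 then - (1 / 2) else 0) *: w').
split; [exact: LW|by apply: subspaceD; [|exact: LW|exact: subspaceZ]|].
congr (_ + _); rewrite linearD linearZ /=; congr (_ + _).
case: m => [|[|m]]; first by rewrite mul0r !add0r.
  by rewrite scale0r [act _ w']HW // scaler0.
by rewrite scale0r act_vect_ge5 ?doubleS // scaler0.
Qed.

Definition even_ker_G1 : set V := [set w | homog false w /\ act H w = 0].

(** The commutator of L_m and G_(3/2) is a multiple of G_(m + 3/2), which is
    G_(3/2) itself for m = 0 and vanishes otherwise. *)
Lemma even_ker_G1_submodule : even_submodule even_ker_G1.
Proof.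
have sK : subspace even_ker_G1.
  apply: subspaceI => [|a u w [hu Hu] [hw Hw]].
    by split; [exact: homog0|rewrite linear0].
  split; first by apply: subspaceP => //; apply: homog_subspace.
  by rewrite linearP /= Hu Hw scaler0 addr0.
split=> // x w hx [hw Hw]; apply: subspace_act => // k /hx k_even.
rewrite -(odd_double_half k) k_even add0n -/(b2_L F _).
move: (k./2) => m; split; first exact: (act_homog (@b2_L_homog m) hw).
have := act_LG m 1 w; rewrite Hw linear0.
have -> : act (b2_G F (m + 1)) w = 0.
  by case: m => [//|m]; rewrite act_vect_ge5 // addSn addn1.
by rewrite scaler0 addr0.
Qed.

(** * Simple modules *)

Section Simple.
Hypothesis simpleV : simple_module V.

Lemma sum_GW_full W : even_submodule W -> W `<=` homog false ->
  (forall w, W w -> act H w = 0) -> W <> [set 0] -> sum_GW W = [set: V].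
Proof.
move=> eW W0 HW nzW; have [_ /(_ _ (sum_GW_submodule eW W0 HW)) [N0|//]] := simpleV.
case: nzW; apply/seteqP; split=> [w Ww|_ ->]; last exact: (subspace0 eW.1).
by rewrite -N0; exists w, 0; rewrite linear0 addr0; split=> //; apply: subspace0 eW.1.
Qed.

(** An even vector w + G w' equals w, since G w' is odd. *)
Lemma homog_sum_GW W : W `<=` homog false -> sum_GW W = [set: V] ->
  W = homog false.
Proof.
move=> W0 N1; apply/seteqP; split=> // v hv.
have [w [w' [Ww Ww' e]]] : sum_GW W v by rewrite N1.
have [-> //] := homog_eq hv (homog0 V true) (W0 _ Ww) (act_G_odd 0 (W0 _ Ww'))
  (etrans (addr0 v) e).
Qed.

(** Either H v = 0 or H v is a nonzero vector of the kernel, as H^2 = 0; then one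
    of the two homogeneous components of a kernel vector is nonzero, and both lie
    in the kernel because H exchanges the parities. *)
Lemma ker_G1_homogeneous :
  exists i v, [/\ v <> 0, homog i v & act H v = 0].
Proof.
have [v [nzv Hv]] : exists v, v <> 0 /\ act H v = 0.
  have [[v nzv] _] := simpleV; have [Hv|nzHv] := pselect (act H v = 0).
    by exists v.
  by exists (act H v); rewrite act_G1_G1.
have [a [b [ha hb e]]] := homog_decomp v.
have Hb : homog false (act H b) := act_homog (@b2_G_homog 1) hb.
have [Hb0 Ha0] := homog_eq Hb (act_G_odd 1 ha) (homog0 V false) (homog0 V true)
  (etrans (etrans (addrC _ _) (esym (linearD (act H) a b)))
          (etrans (etrans (congr1 (act H) (esym e)) Hv) (esym (addr0 0)))).
have [a0|nza] := pselect (a = 0); last by exists false, a.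
by exists true, b; split=> // b0; apply: nzv; rewrite e a0 b0 addr0.
Qed.

(** The existence of [v] makes the even kernel of H nonzero, so it fills V_0bar.
    From then on every L_0bar-submodule of V_0bar is killed by H, and the same
    argument applies to it. *)
Lemma is_sum_homog v : v <> 0 -> homog false v -> act H v = 0 ->
  is_sum_U_GU (homog false : set V).
Proof.
move=> nzv hv Hv; pose K := even_ker_G1.
have K0 : K `<=` homog false by move=> w [].
have HK w : K w -> act H w = 0 by case.
have eK : even_submodule K := even_ker_G1_submodule.
have nzK W w : W w -> w <> 0 -> W <> [set 0] by move=> Ww nzw W0; move: Ww; rewrite W0.
have K1 := sum_GW_full eK K0 HK (nzK K v (conj hv Hv) nzv).
have Kfull := homog_sum_GW K0 K1; split=> //.
  rewrite -Kfull; split=> //; first exact: nzK (conj hv Hv) nzv.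
  move=> W eW WK; have [W0|nzW] := pselect (W = [set 0]); [by left|right].
  have WH w : W w -> act H w = 0 by move/WK/HK.
  have W0 : W `<=` homog false by apply: subset_trans K0.
  by rewrite Kfull; apply: homog_sum_GW => //; apply: sum_GW_full.
move=> u; have [w [w' [[hw _] [hw' _] ->]]] : sum_GW K u by rewrite K1.
exists (w, act G w'); split=> /= [|[c _] /= [hc [d hd <-]]].
  by split=> //; exists w'.
by case/(homog_eq hw (act_G_odd 0 hw') hc (act_G_odd 0 hd)) => -> ->.
Qed.

End Simple.
End Action.

Theorem proposition5p2 (R : realType) (V : smodule (b2 R[i])) :
  simple_module V ->
  exists (M : smodule (b2 R[i])) (U : set M),
    is_sum_U_GU U /\ (isomorphic V M \/ isomorphic (parity_change V) M).
Proof.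
move=> sV; have [[] [v [nzv hv Hv]]] := ker_G1_homogeneous sV.
  exists (parity_change V), (homog false); split; last by right; apply: isomorphic_refl.
  exact: (is_sum_homog (V := parity_change V) (simple_parity_change sV) nzv hv Hv).
exists V, (homog false); split; last by left; apply: isomorphic_refl.
exact: (is_sum_homog sV nzv hv Hv).
Qed.
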